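(* Let $\eta_1,\dots,\eta_r$ be an integral basis of $\Lambda^\vee$, let $F=\sum_{\beta\in\mathcal S}N_\beta\Phi_\beta$ be a BPS resummed potential, and let $\mathbf H=(\nabla_{\eta_i}\nabla_{\eta_j}F)_{i,j}$ with classical limit $\mathbf H^{\rm cl}$. Fix a primitive effective class $\rho\in\Lambda$, write $\mathbf v=(\langle\rho,\eta_i\rangle)_{i=1}^r$, and set $\mathbf C_m=-[q^{m\rho}]\mathbf H^{\rm cl}$ for $m\ge1$. Then for every $m\ge1$, $$N_{m\rho}\,\mathbf v\mathbf v^T=\frac1{m^2}\sum_{s\mid m}\frac{\mu(s)}{s}\,\mathbf C_{m/s},$$ where $\mu$ is the Möbius function. Thus the matrices $(\mathbf C_m)_{m\ge1}$ determine the complete BPS spectrum $(N_{m\rho})_{m\ge1}$ on the primitive ray spanned by $\rho$.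
   Context: $\Lambda$ is a free abelian group of rank $r$ (the curve class lattice), $\Lambda^\vee=\operatorname{Hom}(\Lambda,\mathbb Z)$, and $\langle\cdot,\cdot\rangle$ is the pairing between them. Fix a pointed effective monoid $\Lambda_+\subset\Lambda$; effective classes are nonzero elements of $\Lambda_+$. All series in the Novikov variables $q^\beta=e^{2\pi i\langle\beta,t\rangle}$ are understood in the completion of the group algebra with respect to $\Lambda_+$, with coefficients meromorphic functions of $\lambda$; $[q^\beta]$ denotes the coefficient of $q^\beta$ (taken entrywise for matrices). $\mathcal S\subset\Lambda_+\setminus\{0\}$ is the BPS support and $N_\beta\in\mathbb Z$ is the genus zero BPS multiplicity, with $N_\beta=0$ for $\beta\notin\mathcal S$. For an effective class $\beta$, $$\Phi_\beta(\lambda,t)=\sum_{k\ge1}\frac{q^{k\beta}}{k(2\sin(k\lambda/2))^2},\qquad F(\lambda,t)=\sum_{\beta\in\mathcal S}N_\beta\Phi_\beta(\lambda,t).$$ For $\eta\in\Lambda^\vee$ and $h=\lambda/(2\pi)$, the half step translations $T_{\pm h\eta/2}$ act coefficientwise by $T_{\pm h\eta/2}q^\beta=e^{\pm i\lambda\langle\beta,\eta\rangle/2}q^\beta$, and $\nabla_\eta=T_{h\eta/2}-T_{-h\eta/2}$. The coefficients of $\mathbf H$ are Laurent polynomials in $e^{i\lambda/2}$, and $\mathbf H^{\rm cl}=\mathbf H|_{\lambda=0}$ is obtained by evaluating them at $\lambda=0$. *)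

(* Defs.v *)
From HB Require Import structures.
From mathcomp Require Import all_boot all_order all_algebra.
From mathcomp Require Import all_classical all_reals all_analysis.
From mathcomp Require Export complex.

Set Implicit Arguments.
Unset Strict Implicit.
Unset Printing Implicit Defensive.

Import Order.TTheory GRing.Theory Num.Theory.
Import numFieldNormedType.Exports.

Local Open Scope classical_set_scope.
Local Open Scope ring_scope.
Local Open Scope complex_scope.

Definition free_abelian_of_rank (r : nat) (L : zmodType) : Prop :=
  exists e : 'I_r -> L, forall x : L,
    exists! c : 'rV[int]_r, x = \sum_i e i *~ c 0 i.

(* The dual lattice Hom(L, Z) is {additive L -> int}, and <b, eta> is eta b. *)
Definition dual_basis (r : nat) (L : zmodType)
    (eta : 'I_r -> {additive L -> int}) : Prop :=
  forall phi : {additive L -> int},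
    exists! c : 'rV[int]_r, forall b : L, phi b = \sum_i c 0 i * eta i b.

Definition pointed_monoid (L : zmodType) (P : set L) : Prop :=
  [/\ P 0, (forall x y, P x -> P y -> P (x + y))
    & (forall x, P x -> P (- x) -> x = 0)].

Definition effective (L : zmodType) (P : set L) : set L := P `\ 0.

Definition primitive (L : zmodType) (x : L) : Prop :=
  x != 0 /\ forall (k : nat) (y : L), x = y *+ k -> k = 1%N.

Definition bps_data (L : zmodType) (P S : set L) (N : L -> int) : Prop :=
  S `<=` effective P /\ forall b, ~ S b -> N b = 0.

Definition moebius (n : nat) : int :=
  if (0 < n)%N && all (fun p => logn p n == 1%N) (primes n)
  then (-1) ^+ size (primes n) else 0.

Definition cexp (R : realType) (z : R[i]) : R[i] :=
  (expR (complex.Re z))%:C * (cos (complex.Im z) +i* sin (complex.Im z)).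

Definition csin (R : realType) (z : R[i]) : R[i] :=
  (cexp ('i * z) - cexp (- ('i * z))) / (2 * 'i).

(* A meromorphic function of lambda is represented by a total function on the
   complex plane. Its values at the poles of the defining expressions are
   meaningless (division by 0 returns 0), so two representatives are identified
   when they agree on a punctured neighbourhood of every point, that is, off a
   closed discrete set. *)
Definition mero_eq (C : numFieldType) (f g : C -> C) : Prop :=
  forall a : C, \forall z \near a^', f z = g z.

(* A Novikov series is given by its family of coefficients: [q^b] a is a b. *)
Definition novikov (L : zmodType) (A : Type) : Type := L -> A.

Definition coefq (L : zmodType) (A : Type) (b : L) (a : novikov L A) : A := a b.

(* The coefficient of q^g in the sum over k >= 1. At most one k contributes,
   because b != 0 and L is torsion free. *)
Definition Phi (R : realType) (L : zmodType) (b : L) :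
    novikov L (R[i] -> R[i]) := fun g l =>
  \sum_(k \in [set k : nat | (0 < k)%N /\ b *+ k = g])
    (k%:R * (2 * csin (k%:R * l / 2)) ^+ 2)^-1.

(* Summed coefficientwise. For g != 0 only the finitely many b with k b = g for
   some k >= 1 contribute to [q^g], so the finitely supported sum is the sum in
   the completion, even when S is infinite. *)
Definition potential (R : realType) (L : zmodType) (S : set L) (N : L -> int) :
    novikov L (R[i] -> R[i]) := fun g l =>
  \sum_(b \in S) (N b)%:~R * Phi b g l.

(* T_{e h eta / 2} for a sign e. *)
Definition half_step (R : realType) (L : zmodType) (e : int)
    (eta : {additive L -> int}) (a : novikov L (R[i] -> R[i])) :
    novikov L (R[i] -> R[i]) := fun b l =>
  cexp (e%:~R * ('i * l * (eta b)%:~R / 2)) * a b l.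

Definition nabla (R : realType) (L : zmodType)
    (eta : {additive L -> int}) (a : novikov L (R[i] -> R[i])) :
    novikov L (R[i] -> R[i]) := fun b l =>
  half_step 1 eta a b l - half_step (-1) eta a b l.

Definition hessian (R : realType) (L : zmodType) (r : nat)
    (eta : 'I_r -> {additive L -> int}) (F : novikov L (R[i] -> R[i])) :
    'M[novikov L (R[i] -> R[i])]_r :=
  \matrix_(i, j) nabla (eta i) (nabla (eta j) F).

(* The pair (p, n) stands for the Laurent polynomial x^(-n) p(x). *)
Definition laurent_at (R : realType) (p : {poly R[i]} * nat) (x : R[i]) : R[i] :=
  p.1.[x] / x ^+ p.2.

Definition laurent_fun (R : realType) (p : {poly R[i]} * nat) (l : R[i]) : R[i] :=
  laurent_at p (cexp ('i * l / 2)).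

(* A coefficient that is a Laurent polynomial in e^{i lambda / 2}, evaluated at
   lambda = 0. The raw value f 0 would be wrong: the expression for f divides
   by sin^2 there. The Laurent polynomial is chosen; any two choices define the
   same function of lambda. *)
Definition at_lambda0 (R : realType) (f : R[i] -> R[i]) : R[i] :=
  laurent_fun (xget (0, 0%N) [set p | mero_eq f (laurent_fun p)]) 0.

Definition classical_limit (R : realType) (L : zmodType) (r : nat)
    (H : 'M[novikov L (R[i] -> R[i])]_r) : 'M[novikov L R[i]]_r :=
  map_mx (fun a b => at_lambda0 (coefq b a)) H.

(* C_m = - [q^(m rho)] H^cl for the potential with BPS data (S, N). *)
Definition ray_matrix (R : realType) (L : zmodType) (r : nat)
    (eta : 'I_r -> {additive L -> int}) (S : set L) (N : L -> int)
    (rho : L) (m : nat) : 'M[R[i]]_r :=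
  - map_mx (coefq (rho *+ m))
      (classical_limit (hessian eta (potential (R := R) S N))).

(* Main.v *)
From HB Require Import structures.
Require Import Defs.
From mathcomp Require Import all_boot all_order all_algebra.
From mathcomp Require Import all_classical all_reals all_analysis.
From mathcomp Require Import ring.

Set Implicit Arguments.
Unset Strict Implicit.
Unset Printing Implicit Defensive.

Import Order.TTheory GRing.Theory Num.Theory.
Import numFieldNormedType.Exports.

Local Open Scope classical_set_scope.
Local Open Scope ring_scope.
Local Open Scope complex_scope.

(** Write x = e^{i l / 2} and let rho be primitive. A class b satisfies
    k b = m rho only if k divides m and b = d rho with d = m / k
    ([primitive_multiple]), so the coefficient of q^{m rho} in the potential
    is a sum over the divisors d of m ([potential_ray]).

    On q^{m rho} the operator nabla_eta multiplies by x^n - x^{-n} with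
    n = m <rho, eta>, and (2 sin (k l / 2))^2 = - (x^k - x^{-k})^2. Because
    m = k d, each quotient (x^n - x^{-n}) / (x^k - x^{-k}) is the q-number
    of d <rho, eta> at x^k: a Laurent polynomial in x ([q_numberE]) whose value
    at x = 1 is d <rho, eta>. Hence the classical limit may be taken term by
    term, and [ray_matrixE] gives
      m C_m = (sum over d dividing m of d^3 N_{d rho}) v v^T.
    Moebius inversion ([moebius_inversion]) solves this for N_{m rho} v v^T.

    The spectrum is then determined because v is nonzero: if every eta_i killed
    rho, so would every coordinate functional ([dual_basis_separates]).

    Passing to the classical limit takes two facts about functions of l. The
    quotients above are valid off the zeros of e^{i m l} - 1, which are isolated
    ([cexp_eq1_isolated]): two of them at distance less than pi / m coincide.
    The value at l = 0 does not depend on the Laurent polynomial chosen to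
    represent a coefficient ([at_lambda0E]): the difference of two choices
    vanishes at e^t for infinitely many t near 0. *)

(** * Moebius inversion *)

Lemma moebiusMprime (p d : nat) : prime p -> (0 < d)%N -> ~~ (p %| d)%N ->
  moebius (p * d) = - moebius d.
Proof.
move=> p_pr d_gt0 pNd; have p_gt0 := prime_gt0 p_pr.
have primesE : perm_eq (primes (p * d)) (p :: primes d).
  apply: uniq_perm; rewrite ?primes_uniq //= ?primes_uniq ?mem_primes.
    by rewrite (negPf pNd) !andbF.
  by move=> q; rewrite primesM // primes_prime // !inE.
rewrite /moebius muln_gt0 p_gt0 d_gt0 /= (perm_all _ primesE) (perm_size primesE) /=.
have -> : logn p (p * d) == 1%N.
  by rewrite lognM // logn_prime // eqxx lognE p_pr d_gt0 (negPf pNd).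
have -> : all (fun q => logn q (p * d) == 1%N) (primes d)
        = all (fun q => logn q d == 1%N) (primes d).
  apply: eq_in_all => q; rewrite mem_primes => /and3P[q_pr _ q_d].
  rewrite lognM // logn_prime //; case: (q =P p) => // eq_qp.
  by rewrite -eq_qp q_d in pNd.
rewrite /=; case: ifP => _; last by rewrite oppr0.
by rewrite exprS mulN1r.
Qed.

Lemma moebius_sqr_dvd (p d : nat) : prime p -> (p ^ 2 %| d)%N -> moebius d = 0.
Proof.
move=> p_pr p2d; rewrite /moebius; case: posnP => //= d_gt0.
case: allP => // /(_ p); rewrite mem_primes p_pr d_gt0 (dvdn_trans _ p2d) ?dvdn_exp //.
move=> /(_ isT) /eqP lp; have := p2d; by rewrite pfactor_dvdn // lp.
Qed.

(** A summation range that does not depend on n, as exchanging sums needs. *)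
Lemma big_divisors (V : nmodType) (M n : nat) (F : nat -> V) : (0 < n <= M)%N ->
  \sum_(d <- divisors n) F d = \sum_(d < M.+1 | (d %| n)%N) F d.
Proof.
move=> /andP[n_gt0 le_nM].
rewrite -(big_mkord (fun d => (d %| n)%N) F) -big_filter.
apply: perm_big; apply: uniq_perm; rewrite ?divisors_uniq ?filter_uniq ?iota_uniq //.
move=> d; rewrite mem_filter mem_index_iota -dvdn_divisors //.
case: (boolP (d %| n)%N) => //= dn; rewrite ltnS.
by rewrite (leq_trans (dvdn_leq n_gt0 dn)).
Qed.

(** Fix a prime p dividing n > 1. Divisors divisible by p^2 contribute 0, and
    d |-> p d matches the divisors prime to p with those divisible by p exactly
    once, with opposite signs. *)
Lemma sum_moebius (n : nat) : (0 < n)%N ->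
  \sum_(d <- divisors n) moebius d = (n == 1%N)%:R.
Proof.
move=> n_gt0; case: eqP => [->|/eqP n_neq1].
  by rewrite big_seq1.
have n_gt1 : (1 < n)%N by case: n n_gt0 n_neq1 => [|[]].
have p_pr := pdiv_prime n_gt1; have p_n := pdiv_dvd n.
set p := pdiv n in p_pr p_n; have p_gt0 := prime_gt0 p_pr.
pose free (d : nat) := ~~ (p %| d)%N.
pose simple (d : nat) := (p %| d)%N && ~~ (p ^ 2 %| d)%N.
have permE : perm_eq (seq.filter simple (divisors n))
    [seq (p * d)%N | d <- seq.filter free (divisors n)].
  apply: uniq_perm; rewrite ?filter_uniq ?divisors_uniq //.
    rewrite map_inj_uniq ?filter_uniq ?divisors_uniq // => x y /eqP.
    by rewrite eqn_pmul2l // => /eqP.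
  move=> e; rewrite mem_filter -dvdn_divisors //; apply/idP/mapP.
    case/andP=> /andP[/dvdnP[d ->]]; rewrite expnS expn1 mulnC dvdn_pmul2l // => pd pdn.
    exists d => //; rewrite mem_filter /free pd -dvdn_divisors //.
    exact: dvdn_trans (dvdn_mull _ (dvdnn d)) pdn.
  case=> d; rewrite mem_filter /free -dvdn_divisors // => /andP[pd dn] ->.
  rewrite /simple dvdn_mulr // expnS expn1 dvdn_pmul2l // pd /=.
  by rewrite Gauss_dvd ?p_n ?dn // prime_coprime.
rewrite (bigID free) /= addrC (bigID (fun d => (p ^ 2 %| d)%N)) /=.
rewrite [X in X + _ + _]big1 ?add0r.
  rewrite (eq_bigl simple) => [|d]; last by rewrite /free negbK.
  rewrite -big_filter (perm_big _ permE) big_map -[X in _ + X]big_filter -big_split /=.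
  rewrite big_seq big1 // => d; rewrite mem_filter -dvdn_divisors // => /andP[pd dn].
  by rewrite moebiusMprime ?addNr // (dvdn_gt0 n_gt0 dn).
by move=> d /andP[_]; apply: moebius_sqr_dvd.
Qed.

(** Exchanging the sums over s and d leaves, for each d, the sum of [moebius]
    over the divisors of n / d, which vanishes unless d = n. *)
Lemma moebius_inversion (V : zmodType) (f g : nat -> V) :
  (forall n, (0 < n)%N -> g n = \sum_(d <- divisors n) f d) ->
  forall n, (0 < n)%N -> f n = \sum_(s <- divisors n) g (n %/ s)%N *~ moebius s.
Proof.
move=> gE n n_gt0.
have swap s d : (s %| n)%N && (d %| n %/ s)%N = (d %| n)%N && (s %| n %/ d)%N.
  have half a b : (a %| n)%N && (b %| n %/ a)%N -> (b %| n)%N && (a %| n %/ b)%N.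
    case/andP=> an bna; have b_n := dvdn_trans bna (dvdn_div an).
    by rewrite b_n dvdn_divRL // mulnC -dvdn_divRL.
  by apply/idP/idP; apply: half.
have divisor_range s : (s %| n)%N -> (0 < n %/ s <= n)%N.
  move=> sn; rewrite leq_div // divn_gt0 ?(dvdn_gt0 n_gt0 sn) //.
  by rewrite (dvdn_leq n_gt0 sn).
transitivity (\sum_(s < n.+1 | (s %| n)%N)
                \sum_(d < n.+1 | (d %| n %/ s)%N) f d *~ moebius s).
  rewrite (exchange_big_dep (fun d : 'I_n.+1 => (d %| n)%N)) /=; last first.
    by move=> s d sn dns; apply: dvdn_trans dns (dvdn_div sn).
  transitivity (\sum_(d < n.+1 | (d %| n)%N) f d *~ (n %/ d == 1)%N%:R).
    rewrite (bigD1 ord_max) //= divnn n_gt0 mulr1z big1 ?addr0 // => d /andP[dn].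
    rewrite -val_eqE /= (eq_sym (n %/ d)%N) eqn_div ?(dvdn_gt0 n_gt0 dn) //.
    rewrite mul1n => /negPf ->.
    by rewrite mulr0z.
  apply: eq_bigr => d dn.
  rewrite -sum_moebius ?(proj1 (andP (divisor_range _ dn))) //.
  rewrite (@big_divisors _ n) ?divisor_range // mulrz_sumr.
  by apply: eq_bigl => s; rewrite swap dn.
rewrite (@big_divisors _ n) ?n_gt0 ?leqnn //; apply: eq_bigr => s sn.
rewrite gE ?(proj1 (andP (divisor_range _ sn))) // (@big_divisors _ n) ?divisor_range //.
by rewrite mulrz_suml.
Qed.

(** * Primitive classes in a free lattice *)

Section Lattice.
Variables (r : nat) (L : zmodType).
Hypothesis Lfree : free_abelian_of_rank r L.

(** The coordinate functionals of a basis. *)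
Lemma coordinates_separate :
  exists phi : 'I_r -> {additive L -> int},
    forall x, (forall i, phi i x = 0) -> x = 0.
Proof.
case: Lfree => e coord_ex.
have coord x : {c : 'rV[int]_r | x = \sum_i e i *~ c 0 i &
    forall c' : 'rV[int]_r, x = \sum_i e i *~ c' 0 i -> c = c'}.
  by have /cid[c [xE c_uniq]] := coord_ex x; exists c.
pose phi i x := s2val (coord x) 0 i.
have phiE x : x = \sum_i e i *~ phi i x by rewrite /phi; case: (coord x).
have phi_uniq x (c : 'rV_r) : x = \sum_i e i *~ c 0 i -> forall i, phi i x = c 0 i.
  by move=> xE i; rewrite /phi; case: (coord x) => c' _ /= /(_ c xE) ->.
have phiB i : zmod_morphism (phi i).
  move=> x y; rewrite (phi_uniq _ (\row_j (phi j x - phi j y))) ?mxE //.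
  rewrite [in LHS](phiE x) [in LHS](phiE y) -sumrB.
  by apply: eq_bigr => j _; rewrite mxE mulrzBr.
pose M i := GRing.isZmodMorphism.Build _ _ (phi i) (phiB i).
pose add_phi i : {additive L -> int} := HB.pack (phi i) (M i).
exists add_phi => x phi0; rewrite (phiE x) big1 // => i _.
by rewrite (phi0 i : phi i x = 0) mulr0z.
Qed.

Lemma free_torsion_free (x : L) (k : nat) : (0 < k)%N -> x *+ k = 0 -> x = 0.
Proof.
move=> k_gt0 xk0; have [phi phi_sep] := coordinates_separate.
apply: phi_sep => i; have /eqP := congr1 (phi i) xk0.
by rewrite raddfMn raddf0 mulrn_eq0 eqn0Ngt k_gt0 => /eqP.
Qed.

Lemma free_mulrn_inj (x y : L) (k : nat) : (0 < k)%N -> x *+ k = y *+ k -> x = y.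
Proof.
move=> k_gt0 /eqP; rewrite -subr_eq0 -mulrnBl => /eqP /(free_torsion_free k_gt0) /eqP.
by rewrite subr_eq0 => /eqP.
Qed.

Lemma ray_inj (rho : L) : rho != 0 -> injective (GRing.natmul rho).
Proof.
move=> rho_neq0 a b; wlog: a b / (a <= b)%N => [wl|le_ab /esym/eqP].
  by case/orP: (leq_total a b) => h /esym e; [symmetry in e |]; move/wl: e => /(_ h).
rewrite -subr_eq0 -mulrnBr // => /eqP eq0.
case: (posnP (b - a)) => [/eqP|ab_gt0].
  by rewrite subn_eq0 => le_ba; apply/eqP; rewrite eqn_leq le_ab.
by rewrite (free_torsion_free ab_gt0 eq0) eqxx in rho_neq0.
Qed.

(** With k' and m' the quotients of k and m by their gcd, torsion freeness gives
    k' b = m' rho, and Bezout makes rho a multiple of k'. Primitivity forces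
    k' = 1. *)
Lemma primitive_multiple (rho b : L) (k m : nat) :
  primitive rho -> (0 < k)%N -> b *+ k = rho *+ m ->
  (k %| m)%N /\ b = rho *+ (m %/ k).
Proof.
move=> [rho_neq0 rho_prim] k_gt0 bk.
have [u v uv _] := egcdnP m k_gt0.
(* Bezout: u * k = v * m + gcdn k m. *)
set d := gcdn k m in uv; have d_gt0 : (0 < d)%N by rewrite gcdn_gt0 k_gt0.
have [k' kE] : exists k', k = (k' * d)%N by apply/dvdnP; apply: dvdn_gcdl.
have [m' mE] : exists m', m = (m' * d)%N by apply/dvdnP; apply: dvdn_gcdr.
have bk' : b *+ k' = rho *+ m'.
  by apply: (free_mulrn_inj d_gt0); rewrite -!mulrnA -kE -mE.
have uv' : (u * k' = v * m' + 1)%N.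
  by apply/eqP; rewrite -(eqn_pmul2r d_gt0) mulnDl -!mulnA -kE -mE mul1n uv.
have k'1 : k' = 1%N.
  apply: (rho_prim _ (rho *+ u - b *+ v)).
  rewrite mulrnBl -!mulrnA uv' (mulnC v k') mulrnA bk' -mulrnA (mulnC m' v).
  by rewrite mulrnDr addrC addKr.
move: bk'; rewrite k'1 mul1n in kE *.
by rewrite kE {1}mE dvdn_mull // mE mulnK // => ->.
Qed.

(** The eta_i generate the dual lattice, in particular the coordinate
    functionals. *)
Lemma dual_basis_separates (eta : 'I_r -> {additive L -> int}) (x : L) :
  dual_basis eta -> x != 0 -> exists i, eta i x != 0.
Proof.
move=> eta_basis; apply: contra_neqP => /forallNP eta0.
have [phi phi_sep] := coordinates_separate; apply: phi_sep => i.
have [c [-> _]] := eta_basis (phi i); rewrite big1 // => j _.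
by move/negP: (eta0 j); rewrite negbK => /eqP ->; rewrite mulr0.
Qed.
End Lattice.

(** * Isolated zeros of the complex exponential *)

Lemma dnbhs_distP (C : numFieldType) (a : C) (Q : C -> Prop) :
  (\forall z \near a^', Q z) <->
  exists2 e : C, 0 < e & forall z, z != a -> `|z - a| < e -> Q z.
Proof.
split=> [/nbhs_ballP[e e_gt0 eQ]|[e e_gt0 eQ]].
  by exists e => // z za ze; apply: eQ => //; rewrite -ball_normE /= distrC.
apply/nbhs_ballP; exists e => // z; rewrite -ball_normE /= distrC => ze za.
exact: eQ.
Qed.

Section Exp.
Variable R : realType.
Implicit Types z w : R[i].

Lemma cexpD z w : cexp (z + w) = cexp z * cexp w.
Proof.
case: z => a b; case: w => c d; rewrite /cexp /= expRD cosD sinD.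
by apply/eqP; rewrite eq_complex /=; apply/andP; split; apply/eqP; ring.
Qed.

Lemma cexp0 : cexp 0 = 1 :> R[i].
Proof. by rewrite /cexp /= expR0 cos0 sin0 mul1r. Qed.

Lemma cexp_neq0 z : cexp z != 0.
Proof.
apply/eqP => z0; have := cexpD z (- z).
by rewrite subrr cexp0 z0 mul0r => /eqP; rewrite oner_eq0.
Qed.

Lemma cexpN z : cexp (- z) = (cexp z)^-1.
Proof. by apply: (mulfI (cexp_neq0 z)); rewrite -cexpD subrr cexp0 divff // cexp_neq0. Qed.

Lemma cexpMn z (n : nat) : cexp (z *+ n) = cexp z ^+ n.
Proof.
by elim: n => [|n IHn]; rewrite ?mulr0n ?cexp0 ?expr0 // mulrS cexpD IHn exprS.
Qed.

Lemma cexpMz z (n : int) : cexp (z *~ n) = cexp z ^ n.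
Proof. by case: n => n; rewrite ?NegzE ?mulrNz ?cexpN -pmulrn cexpMn. Qed.

Lemma cexp_real (t : R) : cexp t%:C = (expR t)%:C.
Proof. by rewrite /cexp /= cos0 sin0 mulr1. Qed.

Lemma sin_eq0_small (t : R) : `|t| < pi -> sin t = 0 -> t = 0.
Proof.
move=> t_pi sint0; case: (ltgtP t 0) => // t0.
  have : 0 < sin (- t) by rewrite sin_gt0_pi // oppr_gt0 t0 -ltr0_norm.
  by rewrite sinN sint0 oppr0 ltxx.
have : 0 < sin t by rewrite sin_gt0_pi // t0 -(gtr0_norm t0).
by rewrite sint0 ltxx.
Qed.

(** Comparing imaginary parts, e^{-y} sin x = 0 for z = x + i y, where
    |x| <= |z| < pi; so x = 0, and then e^{-y} = 1. *)
Lemma cexp_imag_eq1 z : `|z| < pi%:C -> cexp ('i * z) = 1 -> z = 0.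
Proof.
case: z => x y; rewrite /cexp /= !mul0r !mul1r sub0r add0r => small /eqP.
rewrite eq_complex /= !mul0r subr0 addr0 => /andP[/eqP c1 /eqP s1].
have sinx0 : sin x = 0.
  by move/eqP: s1; rewrite mulf_eq0 gt_eqF ?expR_gt0 //= => /eqP.
have x_small : `|x| < pi.
  rewrite -ltcR; apply: le_lt_trans small.
  exact: (normc_ge_Re (x +i* y)).
have x0 := sin_eq0_small x_small sinx0.
move: c1; rewrite x0 cos0 mulr1 -expR0 => /expR_inj/eqP.
by rewrite oppr_eq0 => /eqP ->.
Qed.

(** The zeros form a subgroup, and by [cexp_imag_eq1] distinct zeros are at
    distance at least d = pi / m. So at most one zero other than a lies within
    d / 2 of a. *)
Lemma cexp_eq1_isolated (m : nat) (a : (R[i] : numFieldType)) : (0 < m)%N ->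
  \forall z \near a^', cexp ('i * z *+ m) != 1.
Proof.
move=> m_gt0; pose zero z := cexp ('i * z *+ m) = 1.
pose d : R[i] := (pi / m%:R)%:C.
have d_gt0 : 0 < d by rewrite ltcR divr_gt0 ?pi_gt0 ?ltr0n.
have zero_sep z w : zero z -> zero w -> `|z - w| < d -> z = w.
  move=> z0 w0 zw; apply/eqP; rewrite -subr_eq0.
  suff /eqP : (z - w) *+ m = 0 by rewrite mulrn_eq0 eqn0Ngt m_gt0.
  apply: cexp_imag_eq1.
    rewrite normrMn -mulr_natr -ltr_pdivlMr ?ltr0n //.
    by rewrite /d rmorphM fmorphV rmorph_nat in zw.
  by rewrite mulrnAr mulrBr mulrnBl cexpD cexpN w0 invr1 mulr1 z0.
have d2_gt0 : 0 < d / 2 by rewrite divr_gt0.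
apply/dnbhs_distP.
have [[z0 [z0_zero z0_a z0_d]]|no_zero] :=
    pselect (exists z, [/\ zero z, z != a & `|z - a| < d / 2]).
  exists `|z0 - a|; first by rewrite normr_gt0 subr_eq0.
  move=> z _ za; apply/eqP => z_zero.
  have zz0 : z = z0.
    apply: zero_sep => //; rewrite -(subrKA a) (le_lt_trans (ler_normD _ _)) //.
    by rewrite [d]splitr ltrD ?(lt_trans za) // distrC.
  by rewrite zz0 ltxx in za.
exists (d / 2) => // z za zd; apply/eqP => z_zero.
by apply: no_zero; exists z.
Qed.

End Exp.

(** * Laurent polynomials and q-numbers *)

(** A predicate on functions, because the pair p is not unique and only g, in
    particular its value at 1, is of interest. *)
Definition is_laurent (C : fieldType) (g : C -> C) : Prop :=
  exists p : {poly C} * nat, forall x, x != 0 -> g x = p.1.[x] / x ^+ p.2.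

Lemma is_laurent_const (C : fieldType) (c : C) : is_laurent (fun=> c).
Proof. by exists (c%:P, 0%N) => x _; rewrite hornerC expr0 divr1. Qed.

Lemma is_laurentX (C : fieldType) : @is_laurent C id.
Proof. by exists ('X, 0%N) => x _; rewrite hornerX expr0 divr1. Qed.

Lemma is_laurentV (C : fieldType) : @is_laurent C GRing.inv.
Proof. by exists (1, 1%N) => x _; rewrite hornerC expr1 mul1r. Qed.

Lemma is_laurentD (C : fieldType) (f g : C -> C) :
  is_laurent f -> is_laurent g -> is_laurent (fun x => f x + g x).
Proof.
move=> [[p n] fE] [[q k] gE]; exists (p * 'X^k + q * 'X^n, (n + k)%N) => x x0.
rewrite fE // gE //= !hornerE exprD.
by rewrite addf_div ?expf_neq0.
Qed.

Lemma is_laurentM (C : fieldType) (f g : C -> C) :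
  is_laurent f -> is_laurent g -> is_laurent (fun x => f x * g x).
Proof.
move=> [[p n] fE] [[q k] gE]; exists (p * q, (n + k)%N) => x x0.
by rewrite fE // gE //= hornerM exprD mulf_div.
Qed.

Lemma is_laurent_sum (C : fieldType) (I : Type) (s : seq I) (f : I -> C -> C) :
  (forall i, is_laurent (f i)) -> is_laurent (fun x => \sum_(i <- s) f i x).
Proof.
move=> fL; elim: s => [|i s IHs].
  have [p pE] := is_laurent_const (0 : C); exists p => x x0.
  by rewrite big_nil -pE.
have [p pE] := is_laurentD (fL i) IHs; exists p => x x0.
by rewrite big_cons -pE.
Qed.

Lemma is_laurent_exp (C : fieldType) (f : C -> C) (n : nat) :
  is_laurent f -> is_laurent (fun x => f x ^+ n).
Proof.
move=> fL; elim: n => [|n IHn].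
  have [p pE] := is_laurent_const (1 : C); exists p => x x0.
  by rewrite expr0 -pE.
have [p pE] := is_laurentM fL IHn; exists p => x x0.
by rewrite exprS -pE.
Qed.

(** The symmetric q-number (x^n - x^{-n}) / (x - x^{-1}), written as a sum so
    that it makes sense at x = 1 as well. *)
Definition q_number (C : fieldType) (n : int) (x : C) : C :=
  (Num.sg n)%:~R * \sum_(i < `|n|%N) x ^+ (`|n|%N.-1 - i) * x^-1 ^+ i.

Lemma q_numberE (C : fieldType) (n : int) (x : C) :
  x ^ n - x ^ (- n) = (x - x^-1) * q_number n x.
Proof.
case: n => n; rewrite /q_number.
  rewrite -exprnN -exprnP -exprVn subrXX /=.
  case: n => [|n]; first by rewrite big_ord0 !mulr0.
  by rewrite gtr0_sg // mul1r.
rewrite NegzE opprK abszN sgrN gtr0_sg //= mulN1r mulrN -subrXX exprVn.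
by rewrite opprB -exprnP.
Qed.

Lemma q_number1 (C : fieldType) (n : int) : q_number n 1 = n%:~R :> C.
Proof.
rewrite /q_number (eq_bigr (fun=> 1)) => [|i _]; last by rewrite invr1 !expr1n mulr1.
rewrite sumr_const card_ord pmulrn -intrM; congr (_%:~R).
by rewrite abszE -numEsg.
Qed.

Lemma is_laurent_q_number (C : fieldType) (n : int) (k : nat) :
  is_laurent (fun x : C => q_number n (x ^+ k)).
Proof.
apply: is_laurentM; first exact: is_laurent_const.
apply: is_laurent_sum => i; apply: is_laurentM.
  by do 2! apply: is_laurent_exp; apply: is_laurentX.
apply: is_laurent_exp.
have [p pE] := is_laurent_exp k (@is_laurentV C); exists p => x x0.
by rewrite -exprVn pE.
Qed.

(** * Evaluation at lambda = 0 *)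

(** Let p represent g and let q be the representative chosen by [at_lambda0].
    Near 0 the functions of l that they define agree, so the polynomial
    D = p.1 X^q.2 - q.1 X^p.2 has infinitely many roots, and D = 0; at X = 1 this
    says that both have the same value at l = 0. *)
Lemma at_lambda0E (R : realType) (f g : R[i] -> R[i]) : is_laurent g ->
  mero_eq f (fun l => g (cexp ('i * l / 2))) -> at_lambda0 f = g 1.
Proof.
move=> [p gE] fg; rewrite /at_lambda0.
have fp : mero_eq f (laurent_fun p).
  move=> a; have /dnbhs_distP[e e0 fge] := fg a.
  by apply/dnbhs_distP; exists e => // z za ze; rewrite fge // gE // cexp_neq0.
set q := xget _ _; have fq : mero_eq f (laurent_fun q).
  have ex : exists p, [set p | mero_eq f (laurent_fun p)] p by exists p.
  exact: (xgetPex (0, 0%N) ex).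
rewrite (gE 1) ?oner_neq0 // /laurent_fun mulr0 mul0r cexp0.
rewrite /laurent_at.
pose D := p.1 * 'X^(q.2) - q.1 * 'X^(p.2).
suff D0 : D = 0.
  have := congr1 (horner^~ 1) D0; rewrite /D !hornerE !expr1n !divr1 !mulr1.
  by move/eqP; rewrite subr_eq0 => /eqP.
have /dnbhs_distP[e e0 fpe] := fp 0; have /dnbhs_distP[e' e'0 fqe] := fq 0.
have [t t0 [te te']] : exists2 t : R, 0 < t & 2 * t%:C <= e /\ 2 * t%:C <= e'.
  have real_bound (c : R[i]) : 0 < c -> exists2 s : R, 0 < s & c = 2 * s%:C.
    case: c => x y; rewrite ltcE /= => /andP[/eqP -> x0].
    exists (x / 2); first by rewrite divr_gt0.
    by rewrite -[2]/(2%:R) -(rmorph_nat (real_complex R)) -rmorphM /= mulrC divfK ?pnatr_eq0.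
  have [s s0 ->] := real_bound e e0; have [s' s'0 ->] := real_bound e' e'0.
  exists (Num.min s s'); first by rewrite lt_min s0.
  by rewrite !ler_pM2l ?ltr0n // !lecR !ge_min !lexx orbT.
(* Infinitely many real points in ]0, t[. The roots used are e^{pt j}, taken at
   l = -2 i (pt j), where exp is visibly injective. *)
pose pt (j : nat) : R := t / j.+2%:R.
have pt0 j : 0 < pt j by rewrite divr_gt0 ?ltr0n.
have ptt j : pt j < t by rewrite ltr_pdivrMr ?ltr0n // ltr_pMr // ltr1n.
have D_root j : root D (expR (pt j))%:C.
  pose l : R[i] := - 'i * 2 * (pt j)%:C.
  have l_exp : 'i * l / 2 = (pt j)%:C.
    by rewrite /l !mulNr mulrN !mulrA -expr2 sqr_i mulN1r !mulNr opprK mulrAC divff ?mul1r.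
  have l_norm : `|l| = 2 * (pt j)%:C.
    have i_norm : `|'i : R[i]| = 1 by rewrite normc_def /= expr0n expr1n add0r sqrtr1.
    by rewrite /l !normrM normrN normr_nat i_norm mul1r gtr0_norm ?ltcR.
  have l0 : l != 0 by rewrite -normr_eq0 l_norm mulf_neq0 ?pnatr_eq0 // gt_eqF // ltcR.
  have l_lt : `|l - 0| < 2 * t%:C by rewrite subr0 l_norm ltr_pM2l ?ltr0n // ltcR.
  have := fpe l l0 (lt_le_trans l_lt te).
  rewrite (fqe l l0 (lt_le_trans l_lt te')) /laurent_fun /laurent_at l_exp cexp_real.
  set y := (expR _)%:C => /eqP.
  have y0 : y != 0 by rewrite /y -cexp_real cexp_neq0.
  rewrite eqr_div ?expf_neq0 // => /eqP yE.
  by rewrite rootE /D !hornerE yE subrr.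
apply/eqP; apply: contraT => Dn0.
pose rs := [seq (expR (pt j))%:C | j <- iota 0 (size D)].
have := max_poly_roots Dn0 (_ : all (root D) rs) (_ : uniq rs).
rewrite size_map size_iota ltnn => -> //.
  by apply/allP => _ /mapP[j _ ->].
rewrite map_inj_uniq ?iota_uniq // => j k /= [/expR_inj].
move=> /(mulfI (lt0r_neq0 t0))/invr_inj/eqP; rewrite eqr_nat => /eqP [].
by [].
Qed.

(** * Coefficients along a primitive ray *)

Section Ray.
Variables (R : realType) (r : nat) (L : zmodType).
Hypothesis Lfree : free_abelian_of_rank r L.
Variables (P S : set L) (N : L -> int) (rho : L).
Hypotheses (SN : bps_data P S N) (rho_primitive : primitive rho).

Let halfexp (l : R[i]) : R[i] := cexp ('i * l / 2).

Lemma sqr_2csin (k : nat) (l : R[i]) :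
  (2 * csin (k%:R * l / 2)) ^+ 2 = - (halfexp l ^+ k - (halfexp l ^+ k)^-1) ^+ 2.
Proof.
rewrite /csin cexpN (_ : 'i * (k%:R * l / 2) = ('i * l / 2) *+ k).
  rewrite cexpMn -/(halfexp l) invfM mulrCA mulVKf ?pnatr_eq0 //.
  by rewrite expr_div_n sqr_i invrN1 mulrN1.
by rewrite -mulr_natl; ring.
Qed.

Lemma nabla_coef (eta : {additive L -> int}) (a : novikov L (R[i] -> R[i])) b l :
  nabla eta a b l = (halfexp l ^ eta b - halfexp l ^ (- eta b)) * a b l.
Proof.
rewrite /nabla /half_step mulr1z mul1r mulrN1z mulN1r cexpN.
have -> : 'i * l * (eta b)%:~R / 2 = ('i * l / 2) *~ eta b.
  by rewrite mulrAC mulrzr.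
by rewrite cexpMz invr_expz mulrBl.
Qed.

Lemma Phi_ray (d m : nat) l : (0 < d)%N -> (d %| m)%N -> (0 < m)%N ->
  Phi (rho *+ d) (rho *+ m) l =
  ((m %/ d)%:R * (2 * csin ((m %/ d)%:R * l / 2)) ^+ 2)^-1 :> R[i].
Proof.
move=> d_gt0 dm m_gt0; rewrite /Phi.
rewrite (_ : [set k | _] = [set (m %/ d)%N]) ?fsbig_set1 //.
apply/seteqP; split=> k /=.
  case=> _; rewrite -mulrnA => /(ray_inj Lfree (proj1 rho_primitive)) <-.
  by rewrite mulKn.
move=> ->; rewrite divn_gt0 // (dvdn_leq m_gt0 dm) -mulrnA.
by rewrite mulnC divnK.
Qed.

(** The sum over S is first extended to all classes, where N vanishes off S, and
    then cut down to the multiples of rho that can contribute. *)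
Lemma potential_ray (m : nat) l : (0 < m)%N ->
  potential S N (rho *+ m) l =
  \sum_(d <- divisors m) (N (rho *+ d))%:~R *
    ((m %/ d)%:R * (2 * csin ((m %/ d)%:R * l / 2)) ^+ 2)^-1 :> R[i].
Proof.
move=> m_gt0; rewrite /potential.
set term := fun b => _; rewrite -[LHS]/(\sum_(b \in S) term b).
rewrite (@fsbig_widen _ _ _ _ S setT) //; last first.
  by move=> b [_ Sb]; rewrite /term /= (proj2 SN b Sb) mul0r.
have ray_set_inj : set_inj [set` divisors m] (fun d => rho *+ d).
  by move=> d e _ _; apply: (ray_inj Lfree (proj1 rho_primitive)).
rewrite -(@fsbig_widen _ _ _ _ ((fun d => rho *+ d) @` [set` divisors m]) setT) //; last first.
  move=> b [_ b_ray]; rewrite /term /= /Phi fsbig1 ?mulr0 // => k [k_gt0 bk].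
  have [km bE] := primitive_multiple Lfree rho_primitive k_gt0 bk.
  case: b_ray; exists (m %/ k)%N => //=.
  by rewrite -dvdn_divisors // dvdn_div.
rewrite fsbig_image // -fsbig_seq ?divisors_uniq //.
rewrite big_seq [RHS]big_seq; apply: eq_bigr => d; rewrite -dvdn_divisors // => dm.
by rewrite /term Phi_ray // (dvdn_gt0 m_gt0 dm).
Qed.

Lemma natr_divn_neq0 (d m : nat) :
  (0 < m)%N -> (d %| m)%N -> (m %/ d)%:R != 0 :> R[i].
Proof.
move=> m_gt0 dm; have d_gt0 := dvdn_gt0 m_gt0 dm; have le_dm := dvdn_leq m_gt0 dm.
by rewrite pnatr_eq0 -lt0n divn_gt0.
Qed.

(** Off the zeros of e^{i m l} - 1, each double pole of the potential cancels
    against the two factors x^n - x^{-n} produced by the difference operators,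
    leaving two q-numbers, which are evaluated at x = 1. *)
Lemma ray_matrixE (eta : 'I_r -> {additive L -> int}) (m : nat) (i j : 'I_r) :
  (0 < m)%N ->
  ray_matrix R eta S N rho m i j = \sum_(d <- divisors m)
    (N (rho *+ d))%:~R / (m %/ d)%:R *
      ((eta i rho * d%:Z)%:~R * (eta j rho * d%:Z)%:~R).
Proof.
move=> m_gt0; pose q_term d x : R[i] := - ((N (rho *+ d))%:~R / (m %/ d)%:R) *
  (q_number (eta i rho * d%:Z) (x ^+ (m %/ d)) * q_number (eta j rho * d%:Z) (x ^+ (m %/ d))).
rewrite /ray_matrix !mxE /coefq.
rewrite (@at_lambda0E _ _ (fun x => \sum_(d <- divisors m) q_term d x)); last 2 first.
- apply: is_laurent_sum => d; apply: is_laurentM; first exact: is_laurent_const.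
  by apply: is_laurentM; apply: is_laurent_q_number.
- move=> a; have /dnbhs_distP[e e_gt0 ea] := cexp_eq1_isolated a m_gt0.
  apply/dnbhs_distP; exists e => // l la le.
  rewrite !nabla_coef potential_ray // mulrA mulr_sumr big_seq [RHS]big_seq.
  apply: eq_bigr => d; rewrite -dvdn_divisors // => dm.
  rewrite sqr_2csin /q_term -/(halfexp l).
  have k0 := natr_divn_neq0 m_gt0 dm.
  set k := (m %/ d)%N; set x := halfexp l.
  have mE : m = (d * k)%N by rewrite mulnC divnK.
  have x0 : x != 0 by apply: cexp_neq0.
  have powE (h : 'I_r) e' : x ^ (e' * eta h (rho *+ m)) = (x ^+ k) ^ (e' * (eta h rho * d%:Z)).
    rewrite exprnP exprz_exp; congr (x ^ _).
    rewrite raddfMn -mulr_natr mE natrM !natz; ring.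
  have diffE h : x ^ eta h (rho *+ m) - x ^ (- eta h (rho *+ m)) =
      (x ^+ k - (x ^+ k)^-1) * q_number (eta h rho * d%:Z) (x ^+ k).
    by rewrite -q_numberE -[eta h (rho *+ m)]mul1r -mulNr !powE mul1r mulN1r.
  rewrite !diffE; set y := x ^+ k - _.
  have y0 : y != 0.
    rewrite subr_eq0; apply: contraTneq (ea l la le) => xk.
    have xk2 : (x ^+ k) ^+ 2 = 1 by rewrite expr2 {2}xk divff ?expf_neq0.
    have -> : 'i * l = ('i * l / 2) *+ 2 by rewrite -mulr_natr divfK ?pnatr_eq0.
    rewrite !cexpMn -/(halfexp l) -/x mE mulnC !exprM (exprAC _ 2 k) xk2.
    by rewrite expr1n eqxx.
  move: y0 k0; rewrite -/k.
  move: (k%:R : R[i]) (q_number _ _) (q_number _ _) (_%:~R : R[i]) => K A B n.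
  move: y => {}y y0 K0; field.
  by rewrite K0 y0.
rewrite -sumrN; apply: eq_bigr => d _.
by rewrite /q_term expr1n !q_number1 mulNr opprK.
Qed.

Lemma ray_matrix_divisor_sum (eta : 'I_r -> {additive L -> int}) (m : nat) :
  let v : 'cV[R[i]]_r := \col_i (eta i rho)%:~R in (0 < m)%N ->
  m%:R *: ray_matrix R eta S N rho m =
  \sum_(d <- divisors m) (d%:R ^+ 3 * (N (rho *+ d))%:~R) *: (v *m v^T).
Proof.
move=> v m_gt0; apply/matrixP => i j; rewrite mxE ray_matrixE // summxE mulr_sumr.
rewrite big_seq [RHS]big_seq; apply: eq_bigr => d; rewrite -dvdn_divisors // => dm.
have d0 : d%:R != 0 :> R[i] by rewrite pnatr_eq0 -lt0n (dvdn_gt0 m_gt0 dm).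
have k0 := natr_divn_neq0 m_gt0 dm.
rewrite !mxE big_ord1 !mxE !intrM -!pmulrn -[in m%:R](divnK dm) natrM.
by field.
Qed.

(** Moebius inversion of [ray_matrix_divisor_sum], divided by m^3. *)
Lemma bps_moebius (eta : 'I_r -> {additive L -> int}) (m : nat) :
  let v : 'cV[R[i]]_r := \col_i (eta i rho)%:~R in (0 < m)%N ->
     (N (rho *+ m))%:~R *: (v *m v^T) =
     (m%:R ^+ 2)^-1 *:
       \sum_(s <- divisors m)
         ((moebius s)%:~R / s%:R) *: ray_matrix R eta S N rho (m %/ s).
Proof.
move=> v m_gt0; have m0 : m%:R != 0 :> R[i] by rewrite pnatr_eq0 -lt0n.
have := moebius_inversion (fun n n_gt0 => @ray_matrix_divisor_sum eta n n_gt0) m_gt0.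
move=> /(congr1 (fun A => (m%:R ^+ 3)^-1 *: A)).
rewrite scalerA mulrA mulVf ?expf_neq0 // mul1r => ->.
rewrite !scaler_sumr big_seq [RHS]big_seq; apply: eq_bigr => s.
rewrite -dvdn_divisors // => sm.
have s0 : s%:R != 0 :> R[i] by rewrite pnatr_eq0 -lt0n (dvdn_gt0 m_gt0 sm).
rewrite -scaler_int !scalerA; congr (_ *: _).
have -> : (m %/ s)%:R = m%:R / s%:R :> R[i] by rewrite -[in m%:R](divnK sm) natrM mulfK.
by field; rewrite m0 s0.
Qed.
End Ray.

Theorem theorem1p2 (R : realType) (r : nat) (L : zmodType)
    (Lfree : free_abelian_of_rank r L)
    (P : set L) (Ppointed : pointed_monoid P)
    (S : set L) (N : L -> int) (SN : bps_data P S N)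
    (eta : 'I_r -> {additive L -> int}) (eta_basis : dual_basis eta)
    (rho : L) (rho_effective : effective P rho) (rho_primitive : primitive rho) :
  let v : 'cV[R[i]]_r := \col_i (eta i rho)%:~R in
  (forall m : nat, (0 < m)%N ->
     (N (rho *+ m))%:~R *: (v *m v^T) =
     (m%:R ^+ 2)^-1 *:
       \sum_(s <- divisors m)
         ((moebius s)%:~R / s%:R) *: ray_matrix R eta S N rho (m %/ s)) /\
  (forall (S' : set L) (N' : L -> int), bps_data P S' N' ->
     (forall m : nat, (0 < m)%N ->
        ray_matrix R eta S' N' rho m = ray_matrix R eta S N rho m) ->
     forall m : nat, (0 < m)%N -> N' (rho *+ m) = N (rho *+ m)).
Proof.
move=> v; split=> [m m_gt0|S' N' SN' eq_ray m m_gt0].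
  exact: (bps_moebius R Lfree SN rho_primitive eta m_gt0).
have [i eta_i] := dual_basis_separates Lfree eta_basis (proj1 rho_primitive).
have sum_ext (A B : nat -> 'M[R[i]]_r) : (forall n, (0 < n)%N -> A n = B n) ->
    \sum_(s <- divisors m) ((moebius s)%:~R / s%:R) *: A (m %/ s)%N =
    \sum_(s <- divisors m) ((moebius s)%:~R / s%:R) *: B (m %/ s)%N.
  move=> eqAB; apply: eq_big_seq => s; rewrite -dvdn_divisors // => sm.
  have s_gt0 := dvdn_gt0 m_gt0 sm.
  by rewrite eqAB // divn_gt0 // dvdn_leq.
have eqN : (N' (rho *+ m))%:~R *: (v *m v^T) = (N (rho *+ m))%:~R *: (v *m v^T).
  have formula := bps_moebius R Lfree SN rho_primitive eta m_gt0.
  have formula' := bps_moebius R Lfree SN' rho_primitive eta m_gt0.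
  have same_sum :=
    sum_ext (ray_matrix R eta S' N' rho) (ray_matrix R eta S N rho) eq_ray.
  rewrite same_sum in formula'.
  exact: etrans formula' (esym formula).
have vi : v i 0 != 0 by rewrite mxE intr_eq0.
move/matrixP/(_ i i): eqN; rewrite !mxE big_ord1 [v^T _ _]mxE.
by move=> /(mulIf (mulf_neq0 vi vi)) /intr_inj.
Qed.
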